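(* Let $R$ be a commutative noetherian ring. Then the following are equivalent: (1) Every $R$-module has a $\mathcal{P}$-cover, i.e., $R$ is perfect; (2) Every $R$-module has a minimal projective resolution.
   Context: $\mathcal{P}$ is the class of projective $R$-modules. A morphism $\phi:P\to M$ with $P\in\mathcal{P}$ is a $\mathcal{P}$-cover of $M$ if (i) every map $P'\to M$ with $P'\in\mathcal{P}$ factors through $\phi$, and (ii) every endomorphism $f:P\to P$ with $\phi f=\phi$ is an isomorphism. A ring is called perfect if every module over it has a $\mathcal{P}$-cover. A projective resolution of $M$ is a complex $P$ of projective modules with $P_i=0$ for $i<0$ and a quasi-isomorphism $P\to M$; it is minimal if it is a minimal complex, where a complex $C$ is minimal if every homotopy equivalence $\gamma:C\to C$ (degree zero chain map) is an isomorphism of complexes. *)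

(* Defs.v *)
From HB Require Import structures.
From mathcomp Require Import all_boot all_order all_algebra.
From mathcomp Require Import boolp classical_sets functions.

Set Implicit Arguments.
Unset Strict Implicit.
Unset Printing Implicit Defensive.

Import GRing.Theory.

Local Open Scope classical_set_scope.
Local Open Scope ring_scope.

Definition is_ideal (R : comPzRingType) (I : set R) : Prop :=
  [/\ I 0,
      forall x y, I x -> I y -> I (x + y) &
      forall a x, I x -> I (a * x)].

Definition ideal_gen (R : comPzRingType) (n : nat) (a : 'I_n -> R) : set R :=
  [set x | exists c : 'I_n -> R, x = \sum_(i < n) c i * a i].

Definition noetherian (R : comPzRingType) : Prop :=
  forall I : set R, is_ideal I ->
    exists (n : nat) (a : 'I_n -> R), I = ideal_gen a.

Section Modules.
Variable R : comPzRingType.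

Definition is_iso (M N : lmodType R) (f : {linear M -> N}) : Prop :=
  exists g : {linear N -> M}, cancel f g /\ cancel g f.

Definition projective (P : lmodType R) : Prop :=
  forall (M N : lmodType R) (g : {linear M -> N}) (h : {linear P -> N}),
    (forall y, exists x, g x = y) ->
    exists k : {linear P -> M}, forall x, g (k x) = h x.

Definition is_Pcover (M P : lmodType R) (phi : {linear P -> M}) : Prop :=
  [/\ projective P,
      forall (P' : lmodType R) (psi : {linear P' -> M}), projective P' ->
        exists k : {linear P' -> P}, forall x, phi (k x) = psi x &
      forall f : {linear P -> P}, (forall x, phi (f x) = phi x) -> is_iso f].

Definition has_Pcover (M : lmodType R) : Prop :=
  exists (P : lmodType R) (phi : {linear P -> M}), is_Pcover phi.

Definition perfect : Prop := forall M : lmodType R, has_Pcover M.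

(* Complexes are indexed by all integers and graded homologically.  The
   differential with target degree i starts in degree 1 + i; as i ranges over
   int this covers every differential, and no transport along equalities
   between degrees is needed, neither here nor in [homotopic]. *)
Record complex : Type := Complex {
  cpx_mod :> int -> lmodType R;
  cpx_d : forall i : int, {linear cpx_mod (1 + i) -> cpx_mod i};
  cpx_dd : forall (i : int) (x : cpx_mod (1 + (1 + i))),
    cpx_d i (cpx_d (1 + i) x) = 0
}.

Record chain_map (C D : complex) : Type := ChainMap {
  chain_fun :> forall i : int, {linear C i -> D i};
  chain_comm : forall (i : int) (x : C (1 + i)),
    chain_fun i (cpx_d C i x) = cpx_d D i (chain_fun (1 + i) x)
}.

Program Definition chain_id (C : complex) : chain_map C C :=
  @ChainMap C C (fun i => idfun) _.

Program Definition chain_comp (C D E : complex)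
    (g : chain_map D E) (f : chain_map C D) : chain_map C E :=
  @ChainMap C E (fun i => g i \o f i) _.
Next Obligation. by rewrite /= !chain_comm. Qed.

Definition is_cpx_iso (C D : complex) (f : chain_map C D) : Prop :=
  exists g : chain_map D C, forall i, cancel (f i) (g i) /\ cancel (g i) (f i).

(* f - g = d s + s d, read off in degree 1 + i for an arbitrary integer i *)
Definition homotopic (C D : complex) (f g : chain_map C D) : Prop :=
  exists s : forall i : int, {linear C i -> D (1 + i)},
    forall (i : int) (x : C (1 + i)),
      f (1 + i) x - g (1 + i) x
      = cpx_d D (1 + i) (s (1 + i) x) + s i (cpx_d C i x).

Definition homotopy_equivalence (C D : complex) (f : chain_map C D) : Prop :=
  exists g : chain_map D C,
    homotopic (chain_comp g f) (chain_id C) /\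
    homotopic (chain_comp f g) (chain_id D).

Definition minimal_complex (C : complex) : Prop :=
  forall gamma : chain_map C C, homotopy_equivalence gamma -> is_cpx_iso gamma.

(* Cycles, boundaries and homology are in degree 1 + i. *)
Definition cycles (C : complex) (i : int) : set (C (1 + i)) :=
  [set x | cpx_d C i x = 0].

Definition boundaries (C : complex) (i : int) : set (C (1 + i)) :=
  range (cpx_d C (1 + i)).

Definition homology_class (C : complex) (i : int) (x : C (1 + i)) :
    set (C (1 + i)) :=
  [set y | boundaries (y - x)].

(* The underlying set of the module cycles / boundaries, as a set of cosets;
   the module structure plays no role, since the induced map in homology is
   linear and a linear map is an isomorphism exactly when it is bijective. *)
Definition homology (C : complex) (i : int) : set (set (C (1 + i))) :=
  @homology_class C i @` @cycles C i.

(* sends the class of x to the class of f x *)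
Definition homology_map (C D : complex) (f : chain_map C D) (i : int)
    (A : set (C (1 + i))) : set (D (1 + i)) :=
  \bigcup_(x in A) homology_class (f (1 + i) x).

Definition quasi_iso (C D : complex) (f : chain_map C D) : Prop :=
  forall i : int,
    set_bij (@homology C i) (@homology D i) (@homology_map C D f i).

(* M as a complex concentrated in degree 0; 'rV[R]_0 is the zero module *)
Definition conc_mod (M : lmodType R) (i : int) : lmodType R :=
  if i is Posz 0 then M else 'rV[R]_0.

Program Definition conc (M : lmodType R) : complex :=
  @Complex (conc_mod M) (fun i => \0) _.

Definition is_proj_resolution (M : lmodType R) (P : complex)
    (f : chain_map P (conc M)) : Prop :=
  [/\ forall i, projective (P i),
      forall i, i < 0 -> forall x : P i, x = 0 &
      quasi_iso f].

Definition has_minimal_proj_resolution (M : lmodType R) : Prop :=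
  exists (P : complex) (f : chain_map P (conc M)),
    is_proj_resolution f /\ minimal_complex P.

End Modules.

(* Main.v *)
From HB Require Import structures.
Require Import Defs.
From mathcomp Require Import all_boot all_order all_algebra.
From mathcomp Require Import boolp classical_sets functions.

Set Implicit Arguments.
Unset Strict Implicit.
Unset Printing Implicit Defensive.

Import GRing.Theory.

Local Open Scope classical_set_scope.
Local Open Scope ring_scope.

(** Covers and minimal resolutions are linked by right minimality: phi is right
minimal when every endomorphism f of its source with phi f = phi is an
isomorphism.  A projective resolution P -> M is minimal as soon as the
augmentation P_0 -> M and all the differentials P_(n+1) -> P_n are right
minimal; conversely the minimality of P makes the augmentation right minimal.  A
projective cover is the same thing as a surjective right minimal map from a
projective module.

From covers to minimal resolutions.  Over a perfect ring one covers M, then the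
kernel of that cover, and so on; this produces a resolution in which the
augmentation and all differentials are right minimal ([iterated_covers]).
If gamma is a homotopy equivalence with homotopy inverse delta, then both
composites are homotopic to the identity, so it suffices that a chain map f
homotopic to the identity is bijective in each degree
([homotopic_id_bijective]).  In degree 0, f_0 is compatible with the
augmentation, hence bijective by right minimality.  If f_n is bijective, then
f_n^-1 d lands in the image of d and so lifts to an endomorphism k of P_(n+1)
with f_n d k = d; then both f_(n+1) k and k f_(n+1) are endomorphisms over d,
thus isomorphisms, and f_(n+1) is bijective.

From minimal resolutions to covers.  If P is a minimal resolution of M, then
P_0 -> M is a cover: an endomorphism of P_0 over M extends to a chain
endomorphism of P ([lift_augmentation_endo]), which by the comparison theorem is
homotopic to the identity ([augmentation_homotopic_id]).  It is then a
homotopy equivalence, so an isomorphism by minimality, and so is its component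
in degree 0. *)

(** * Dependent choice *)

(** Sequences of maps, such as chain maps and homotopies, are built degree by
degree; the type of the n-th term varies with n, and [ok] is the invariant that
allows the construction to go on. *)
Lemma dependent_choice_family (T : nat -> Type) (ok : forall n, T n -> Prop)
    (rel : forall n, T n -> T n.+1 -> Prop) (x0 : T 0) :
  ok 0 x0 ->
  (forall n x, ok n x -> exists y, rel n x y /\ ok n.+1 y) ->
  exists u : forall n, T n, u 0 = x0 /\ forall n, rel n (u n) (u n.+1).
Proof.
move=> ok0 step.
pose next n (x : {x : T n | ok n x}) : {y : T n.+1 | ok n.+1 y} :=
  let y := cid (step n (sval x) (svalP x)) in
  exist _ (sval y) (proj2 (svalP y)).
pose u n := nat_rect (fun n => {x : T n | ok n x}) (exist _ x0 ok0) next n.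
exists (fun n => sval (u n)); split=> // n.
by rewrite /u /= -/(u n); case: cid => y [].
Qed.

(** * Linear maps, projective modules and covers *)

Section Linear.
Variable R : comPzRingType.
Implicit Types M N P : lmodType R.

Lemma is_iso_bijective M N (f : {linear M -> N}) : is_iso f <-> bijective f.
Proof.
split=> [[g [fK gK]]|[g fK gK]]; first by exists g.
pose gL := GRing.isLinear.Build R N M *:%R g (can2_linear fK gK).
pose g' : {linear N -> M} := HB.pack g gL.
by exists g'.
Qed.

Lemma bijective_comp2 (A B : Type) (f : A -> B) (g h : B -> A) :
  bijective (f \o g) -> bijective (h \o f) -> bijective f.
Proof.
move=> [u fgK uK] [v hfK vK].
exists (v \o h) => [x|y]; first exact: hfK.
rewrite -(uK y) /=; congr f; exact: hfK.
Qed.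

Section Submodule.
Variables (M : lmodType R) (S : submodClosed M).

Definition submodule := {x : M | x \in S}.
HB.instance Definition _ := SubType.on submodule.
HB.instance Definition _ := [Choice of submodule by <:].
HB.instance Definition _ := [SubChoice_isSubLmodule of submodule by <:].
End Submodule.

Section RangeKernel.
Variables (M N : lmodType R) (g : {linear M -> N}).

Definition range_pred : {pred N} := fun x => `[< range g x >].

Lemma range_pred_closed : GRing.submod_closed range_pred.
Proof.
split=> [|a x y]; first by apply/asboolP; exists 0; rewrite ?linear0.
move=> /asboolP[u _ <-] /asboolP[v _ <-]; apply/asboolP.
by exists (a *: u + v); rewrite // linearP.
Qed.

HB.instance Definition _ :=
  GRing.isSubmodClosed.Build R N range_pred range_pred_closed.

Definition kernel_pred : {pred M} := fun x => g x == 0.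

Lemma kernel_pred_closed : GRing.submod_closed kernel_pred.
Proof.
split=> [|a x y]; rewrite !unfold_in /kernel_pred ?linear0 //.
by move=> /eqP gx /eqP gy; rewrite linearP gx gy scaler0 addr0.
Qed.

HB.instance Definition _ :=
  GRing.isSubmodClosed.Build R M kernel_pred kernel_pred_closed.
End RangeKernel.

Lemma corestriction P N (S : submodClosed N) (h : {linear P -> N}) :
  (forall x, h x \in S) ->
  exists h' : {linear P -> submodule S}, forall x, val (h' x) = h x.
Proof.
move=> hS; pose h0 x : submodule S := Sub (h x) (hS x).
have h0L : linear h0.
  by move=> a x y; apply: val_inj; rewrite linearP /= linearP.
pose h' : {linear P -> submodule S} :=
  HB.pack h0 (GRing.isLinear.Build R P (submodule S) *:%R h0 h0L).
by exists h'.
Qed.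

(** Corestricting both maps to the range of [g] makes [g] surjective. *)
Lemma projective_lift P M N (g : {linear M -> N}) (h : {linear P -> N}) :
  projective P -> (forall x, exists y, g y = h x) ->
  exists k : {linear P -> M}, forall x, g (k x) = h x.
Proof.
move=> projP hg.
have [h' h'E] : exists h' : {linear P -> submodule (range_pred g)},
    forall x, val (h' x) = h x.
  by apply: corestriction => x; apply/asboolP; have [y <-] := hg x; exists y.
have [g' g'E] : exists g' : {linear M -> submodule (range_pred g)},
    forall x, val (g' x) = g x.
  by apply: corestriction => x; apply/asboolP; exists x.
have surj y : exists x, g' x = y.
  have /asboolP[x _ gx] := valP y.
  by exists x; apply: val_inj; rewrite g'E.
have [k gk] := projP _ _ g' h' surj.
by exists k => x; rewrite -g'E gk h'E.
Qed.

(** The maps from the ring to M given by a |-> a m show that a cover is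
surjective, since they factor through it. *)
Section Multiples.
Variables (M : lmodType R) (m : M).

Definition multiples (a : R^o) : M := a *: m.

Lemma multiples_linear : linear multiples.
Proof. by move=> a x y; rewrite /multiples scalerDl scalerA. Qed.

HB.instance Definition _ :=
  GRing.isLinear.Build R R^o M *:%R multiples multiples_linear.
End Multiples.

Lemma projective_regular : projective (R^o : lmodType R).
Proof.
move=> M N g h surj; have [m gm] := surj (h 1).
exists (multiples m) => x /=.
by rewrite linearZ gm -linearZ /= [_ *: _]mulr1.
Qed.

Lemma Pcover_surjective M P (phi : {linear P -> M}) :
  is_Pcover phi -> forall y, exists x, phi x = y.
Proof.
move=> [_ lift _] y.
have [k phik] := lift _ (multiples y) projective_regular.
by exists (k 1); rewrite phik /= /multiples scale1r.
Qed.

Definition right_minimal M P (phi : {linear P -> M}) : Prop :=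
  forall f : {linear P -> P}, (forall x, phi (f x) = phi x) -> is_iso f.

Lemma surjective_right_minimal_Pcover M P (phi : {linear P -> M}) :
  projective P -> (forall y, exists x, phi x = y) -> right_minimal phi ->
  is_Pcover phi.
Proof. by move=> projP surj rmin; split=> // P' psi projP'; apply: projP'. Qed.

(** * Chain maps and quasi-isomorphisms *)

Lemma chain_map_bijective (C D : complex R) (f : chain_map C D) :
  (forall i, bijective (f i)) -> is_cpx_iso f.
Proof.
move=> bij.
have iso i : {g : {linear D i -> C i} | cancel (f i) g /\ cancel g (f i)}.
  by apply/cid/is_iso_bijective.
pose g i := sval (iso i).
have fK i : cancel (f i) (g i) by have [] := svalP (iso i).
have gK i : cancel (g i) (f i) by have [] := svalP (iso i).
have gC i (x : D (1 + i)) : g i (cpx_d D i x) = cpx_d C i (g (1 + i) x).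
  by apply: (can_inj (fK i)); rewrite gK chain_comm gK.
by exists (ChainMap gC).
Qed.

Lemma homology_class_eq (C : complex R) (i : int) (x y : C (1 + i)) :
  homology_class x = homology_class y <-> boundaries (y - x).
Proof.
split=> [xy|[u _ du]].
  suff: homology_class x y by [].
  by rewrite xy /homology_class /=; exists 0; rewrite // linear0 subrr.
apply/seteqP; split=> z [v _ dv]; rewrite /homology_class /=.
  by exists (v - u); rewrite // linearB du dv opprB addrA subrK.
by exists (v + u); rewrite // linearD du dv addrA subrK.
Qed.

Lemma homology_map_class (C D : complex R) (f : chain_map C D) (i : int)
    (x : C (1 + i)) :
  homology_map f (homology_class x) = homology_class (f (1 + i) x).
Proof.
apply/seteqP; split=> [z [y [u _ du] fz]|z fz]; last first.
  by exists x => //; exists 0; rewrite // linear0 subrr.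
have -> // : homology_class (f (1 + i) x) = homology_class (f (1 + i) y).
apply/homology_class_eq; exists (f _ u) => //.
by rewrite -linearB -du chain_comm.
Qed.

(** The first half is injectivity in homology, the second surjectivity, with
representatives in place of cosets. *)
Lemma quasi_isoP (C D : complex R) (f : chain_map C D) :
  quasi_iso f <-> forall i,
    (forall x : C (1 + i), cycles x -> boundaries (f (1 + i) x) ->
       boundaries x) /\
    (forall y : D (1 + i), cycles y ->
       exists2 x : C (1 + i), cycles x & boundaries (f (1 + i) x - y)).
Proof.
split=> [qf i|Hf i].
  have [_ inj surj] := qf i; split=> [x cx bfx|y cy].
    rewrite -[x]subr0; apply/homology_class_eq.
    apply: inj; rewrite ?inE; last first.
    - rewrite !homology_map_class; apply/homology_class_eq.
      by rewrite linear0 subr0.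
    - by exists x.
    - by exists 0 => //; rewrite /cycles /= linear0.
  have [|_ [x cx <-]] := surj (homology_class y); first by exists y.
  rewrite homology_map_class => /esym/homology_class_eq fxy.
  by exists x.
have [inj surj] := Hf i; split.
- move=> _ [x cx <-]; rewrite homology_map_class; exists (f _ x) => //.
  by rewrite /cycles /= -chain_comm cx linear0.
- move=> A B; rewrite !inE => -[x cx <-] [y cy <-].
  rewrite !homology_map_class => /homology_class_eq; rewrite -linearB => bxy.
  apply/homology_class_eq; apply: inj => //.
  by rewrite /cycles /= linearB cx cy subrr.
- move=> _ [y cy <-]; have [x cx bxy] := surj y cy.
  exists (homology_class x); first by exists x.
  by rewrite homology_map_class; apply/esym/homology_class_eq.
Qed.

(** * Projective resolutions as augmented exact sequences *)

Section NonnegativeComplexes.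
Variable C : complex R.

Definition nonneg_cpx : Prop := forall i : int, i < 0 -> forall x : C i, x = 0.

(** [1 + Posz n] computes to [Posz n.+1], so the differential can be given
source and target indexed by natural numbers without any transport. *)
Definition cpx_dn (n : nat) : {linear C n.+1 -> C n} := cpx_d C n.

Lemma cpx_dndn n x : cpx_dn n (cpx_dn n.+1 x) = 0.
Proof. exact: (@cpx_dd R C n x). Qed.

Record augmented_exact (M : lmodType R) (phi : {linear C 0 -> M}) : Prop :=
  AugmentedExact {
    aug_surj : forall y, exists x, phi x = y;
    aug_d : forall x, phi (cpx_dn 0 x) = 0;
    aug_ker : forall x, phi x = 0 -> exists y, cpx_dn 0 y = x;
    aug_exact : forall n x, cpx_dn n x = 0 -> exists y, cpx_dn n.+1 y = x
  }.

Lemma conc_mod_eq M (i : int) (x y : conc M i) : i != 0 -> x = y.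
Proof.
by case: i x y => [[|n]|n] x y //= _; rewrite (thinmx0 x) (thinmx0 y).
Qed.

(** Homology in degree 0 gives the surjectivity and the kernel of the
augmentation, homology in positive degrees the exactness of the differentials;
negative degrees carry no information. *)
Lemma quasi_iso_augmentation M (f : chain_map C (conc M)) :
  nonneg_cpx -> quasi_iso f <-> augmented_exact (f 0 : {linear C 0 -> M}).
Proof.
move=> C0; rewrite quasi_isoP.
have fd x : f 0 (cpx_dn 0 x) = 0 by rewrite (@chain_comm R C (conc M) f 0).
(* The indices n, [Negz 0] and [Negz n.+1] stand for homology in degrees n + 1, 0
   and below 0. *)
split=> [qf|[surj _ ker ex] [n|[|n]]].
- split=> //.
  + move=> y; have [_ /(_ y erefl)[x _ [u _]]] := qf (Negz 0).
    by move=> /esym/eqP; rewrite subr_eq0 => /eqP ?; exists x.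
  + move=> x fx; have [/(_ x) + _] := qf (Negz 0).
    case=> [||y _ <-]; last by exists y.
      exact: C0.
    by exists 0; rewrite // [RHS]fx.
  + move=> n x dx; have [/(_ x dx) + _] := qf n.
    case=> [|y _ <-]; last by exists y.
    by exists 0 => //; apply: conc_mod_eq.
- split=> [x /ex[y <-] _|y _]; first by exists y.
  exists 0; first exact: linear0.
  by exists 0 => //; apply: conc_mod_eq.
- split=> [x _ [u _ /esym fx]|y _]; first by have [y <-] := ker x fx; exists y.
  have [x <-] := surj y; exists x; first exact: C0.
  by exists 0 => //; apply: (esym (subrr (f 0 x))).
- split=> [x _ _|y _]; first by exists 0; rewrite // linear0 [RHS]C0.
  exists 0; first exact: linear0.
  by exists 0 => //; apply: conc_mod_eq.
Qed.

Variables (M : lmodType R) (phi : {linear C 0 -> M}).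
Hypotheses (C0 : nonneg_cpx) (projC : forall i, projective (C i)).
Hypothesis exC : augmented_exact phi.

(** Induction on the degree n, with the additional claim that f_n^-1 maps the
image of the differential into itself; this is what makes f_n^-1 d liftable
through d.  The claim propagates by exactness. *)
Lemma homotopic_id_bijective (f : chain_map C C) :
  right_minimal phi -> (forall n, right_minimal (cpx_dn n)) ->
  homotopic f (chain_id C) -> forall i, bijective (f i).
Proof.
move=> rmphi rmd [s hs].
have fd (n : nat) x : f n (cpx_dn n x) = cpx_dn n (f n.+1 x).
  exact: (@chain_comm R C C f n x).
have phif x : phi (f 0 x) = phi x.
  apply/eqP; rewrite -subr_eq0 -linearB; apply/eqP.
  (* [Negz 0] is -1, so this is the homotopy relation in degree 0. *)
  have := hs (Negz 0) x; rewrite (C0 _ (cpx_d C (Negz 0) x)) // linear0 addr0.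
  by move=> /= ->; apply: aug_d exC _.
have step (n : nat) : bijective (f n) /\
    forall x, exists y, f n (cpx_dn n y) = cpx_dn n x.
  elim: n => [|n [bijn liftn]].
    have bij0 : bijective (f 0) by apply/is_iso_bijective/rmphi.
    split=> // x; have [g gK fK] := bij0.
    have [|y dy] := aug_ker exC (x := g (cpx_dn 0 x)).
      by rewrite -phif fK (aug_d exC).
    by exists y; rewrite dy fK.
  have [k fdk] : exists k : {linear C n.+1 -> C n.+1},
      forall x, f n (cpx_dn n (k x)) = cpx_dn n x.
    exact: (projective_lift (g := f n \o cpx_dn n)).
  have bijS : bijective (f n.+1).
    apply: (@bijective_comp2 _ _ _ k k).
      by apply/is_iso_bijective/rmd => x; rewrite /= -fd fdk.
    apply/is_iso_bijective/rmd => x /=; apply: (bij_inj bijn).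
    by rewrite fdk fd.
  split=> // x; have [g gK fK] := bijS.
  have [|y dy] := aug_exact exC (n := n) (x := g (cpx_dn n.+1 x)).
    by apply: (bij_inj bijn); rewrite fd fK cpx_dndn linear0.
  by exists y; rewrite dy fK.
case=> n; first by have [] := step n.
by exists id => x; rewrite [LHS]C0 // [RHS]C0.
Qed.

(** Each component is lifted from the previous one; the invariant, that the
component preserves the image of the differential, follows from exactness. *)
Lemma lift_augmentation_endo (f0 : {linear C 0 -> C 0}) :
  (forall x, phi (f0 x) = phi x) ->
  exists f : chain_map C C, f 0 = f0.
Proof.
move=> phif0.
pose T n := {linear C (Posz n) -> C (Posz n)}.
pose ok n (F : T n) := forall x, exists y, cpx_dn n y = F (cpx_dn n x).
pose rel n (F : T n) (G : T n.+1) :=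
  forall x, cpx_dn n (G x) = F (cpx_dn n x).
have ok0 : ok 0 f0.
  by move=> x; apply: (aug_ker exC); rewrite phif0 (aug_d exC).
have [n F okF|u [u0 ud]] := dependent_choice_family (rel := rel) ok0.
  have [G dG] : exists G : T n.+1, rel n F G.
    exact: (projective_lift (h := F \o cpx_dn n)).
  exists G; split=> // x; apply: (aug_exact exC).
  by rewrite dG cpx_dndn linear0.
pose F i : {linear C i -> C i} :=
  match i with Posz n => u n | Negz _ => \0 end.
have FC i (x : C (1 + i)) : F i (cpx_d C i x) = cpx_d C i (F (1 + i) x).
  case: i x => n x; first by rewrite [RHS]ud.
  by rewrite [LHS]C0 // [RHS]C0.
by exists (ChainMap FC).
Qed.

(** The comparison theorem.  The next component of the homotopy lifts
f_(n+1) - 1 - s_n d through d, which is possible by exactness once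
(f_n - 1 - d s_n) d = 0; that identity is the invariant of the construction. *)
Lemma augmentation_homotopic_id (f : chain_map C C) :
  (forall x, phi (f 0 x) = phi x) -> homotopic f (chain_id C).
Proof.
move=> phif.
have fd (n : nat) x : f n (cpx_dn n x) = cpx_dn n (f n.+1 x).
  exact: (@chain_comm R C C f n x).
pose T n := {linear C (Posz n) -> C (Posz n.+1)}.
pose ok n (s : T n) := forall x,
  f n (cpx_dn n x) - cpx_dn n x = cpx_dn n (s (cpx_dn n x)).
pose rel n (s : T n) (t : T n.+1) := forall x,
  f n.+1 x - x = cpx_dn n.+1 (t x) + s (cpx_dn n x).
have [s0 ds0] : exists s0 : T 0, forall x, cpx_dn 0 (s0 x) = f 0 x - x.
  apply: (projective_lift (h := f 0 \- idfun)) => // x.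
  by apply: (aug_ker exC); rewrite linearB /= phif subrr.
have ok0 : ok 0 s0 by move=> x; rewrite ds0.
have [n s oks|u [u0 ud]] := dependent_choice_family (rel := rel) ok0.
  have [t dt] : exists t : T n.+1,
      forall x, cpx_dn n.+1 (t x) = f n.+1 x - x - s (cpx_dn n x).
    pose h := (f n.+1 \- idfun) \- (s \o cpx_dn n).
    apply: (projective_lift (h := h)) => // x; apply: (aug_exact exC).
    by rewrite /= 2!linearB /= -fd oks subrr.
  have rel_st : rel n s t by move=> x; rewrite dt subrK.
  by exists t; split=> // x; rewrite rel_st cpx_dndn linear0 addr0.
exists (fun i : int => match i return {linear C i -> C (1 + i)} with
                 Posz n => u n | Negz _ => \0 end).
case=> [n|[|n]] x; first exact: ud.
  have du0 : cpx_dn 0 (u 0 x) = f 0 x - x by rewrite u0 ds0.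
  by rewrite [RHS]addr0; apply: esym du0.
by rewrite [LHS]C0 // [RHS]C0.
Qed.

End NonnegativeComplexes.

(** * Resolutions by iterated covers *)

(** A sequence indexed by natural numbers is extended by zero to the negative
degrees. *)
Section ExtensionByZero.
Variables (P : nat -> lmodType R) (d : forall n, {linear P n.+1 -> P n}).
Hypothesis dd : forall n x, d n (d n.+1 x) = 0.

Definition nat_cpx_mod (i : int) : lmodType R :=
  if i is Posz n then P n else 'rV[R]_0.

Definition nat_cpx_d (i : int) :
    {linear nat_cpx_mod (1 + i) -> nat_cpx_mod i} :=
  match i with Posz n => d n | Negz n => \0 end.

Lemma nat_cpx_dd i (x : nat_cpx_mod (1 + (1 + i))) :
  @nat_cpx_d i (@nat_cpx_d (1 + i) x) = 0.
Proof.
by case: i x => [n|n] x //=; apply: dd.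
Qed.

Definition nat_cpx : complex R := Complex nat_cpx_dd.
End ExtensionByZero.

Definition conc_map_fun (C : complex R) M (phi : {linear C 0 -> M}) (i : int) :
  {linear C i -> conc M i} :=
  match i with Posz 0 => phi | _ => \0 end.

Lemma conc_map_comm (C : complex R) M (phi : {linear C 0 -> M}) :
  (forall x, phi (cpx_dn C 0 x) = 0) ->
  forall i (x : C (1 + i)),
    conc_map_fun phi i (cpx_d C i x) =
    cpx_d (conc M) i (conc_map_fun phi (1 + i) x).
Proof. by move=> phid [[|n]|n] x //=; apply: phid. Qed.

Section IteratedCovers.
Hypothesis perfR : perfect R.

Definition cover_of (M : lmodType R) :
    {P : lmodType R & {phi : {linear P -> M} | is_Pcover phi}} :=
  let: exist P exphi := cid (perfR M) in existT _ P (cid exphi).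

Definition cover_mod M : lmodType R := projT1 (cover_of M).
Definition cover_map M : {linear cover_mod M -> M} :=
  sval (projT2 (cover_of M)).

Lemma cover_mapP M : is_Pcover (cover_map M).
Proof. exact: svalP (projT2 (cover_of M)). Qed.

Variable M : lmodType R.

Fixpoint syzygy (n : nat) : lmodType R :=
  if n is m.+1 then submodule (kernel_pred (cover_map (syzygy m))) else M.

Definition syzygy_d (n : nat) :
    {linear cover_mod (syzygy n.+1) -> cover_mod (syzygy n)} :=
  val \o cover_map (syzygy n.+1).

Lemma cover_syzygy_d n x : cover_map (syzygy n) (syzygy_d n x) = 0.
Proof. exact/eqP/(valP (cover_map (syzygy n.+1) x)). Qed.

Lemma syzygy_dd n x : syzygy_d n (syzygy_d n.+1 x) = 0.
Proof. by rewrite [LHS](congr1 val (@cover_syzygy_d n.+1 x)). Qed.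

Lemma syzygy_d_surj n x :
  cover_map (syzygy n) x = 0 -> exists y, syzygy_d n y = x.
Proof.
move=> /eqP kx.
have [y dy] := Pcover_surjective (cover_mapP (syzygy n.+1)) (Sub x kx).
by exists y; rewrite /syzygy_d /= dy.
Qed.

(** Following a cover by an injection keeps it right minimal. *)
Lemma syzygy_d_right_minimal n : right_minimal (syzygy_d n).
Proof.
move=> f df; have [_ _] := cover_mapP (syzygy n.+1).
by apply=> x; apply/val_inj/df.
Qed.

Lemma iterated_covers :
  exists (C : complex R) (phi : {linear C 0 -> M}),
    [/\ nonneg_cpx C, forall i, projective (C i), augmented_exact phi,
        right_minimal phi & forall n, right_minimal (cpx_dn C n)].
Proof.
exists (nat_cpx syzygy_dd), (cover_map M); split.
- by case=> // n _ x; apply: thinmx0.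
- case=> n; first by have [] := cover_mapP (syzygy n).
  by move=> A B g h surj; exists \0 => x; rewrite (thinmx0 x) !linear0.
- split=> [||x|n x dx].
  + exact: Pcover_surjective (cover_mapP M).
  + exact: (@cover_syzygy_d 0).
  + exact: (syzygy_d_surj (n := 0)).
  + by apply: syzygy_d_surj; apply: val_inj.
- by have [] := cover_mapP M.
- exact: syzygy_d_right_minimal.
Qed.

End IteratedCovers.

End Linear.

(** * The equivalence *)

Theorem corollary4p4 (R : comPzRingType) (hR : noetherian R) :
  perfect R <-> (forall M : lmodType R, has_minimal_proj_resolution M).
Proof.
split=> [perfR M|minres M].
  have [C [phi [C0 projC exC rmphi rmd]]] := iterated_covers perfR M.
  exists C, (ChainMap (conc_map_comm (aug_d exC))); split.
    by split=> //; apply/quasi_iso_augmentation.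
  (* g f and f g are both homotopic to the identity, hence bijective. *)
  move=> f [g [/(homotopic_id_bijective C0 projC exC rmphi rmd) gf]].
  move=> /(homotopic_id_bijective C0 projC exC rmphi rmd) fg.
  by apply: chain_map_bijective => i; apply: bijective_comp2 (fg i) (gf i).
have [C [f [[projC C0 qf] minC]]] := minres M.
pose phi : {linear C 0 -> M} := f 0.
have exC : augmented_exact phi by apply/quasi_iso_augmentation.
exists (C 0), phi.
apply: (surjective_right_minimal_Pcover (projC 0) (aug_surj exC)).
move=> e phie; have [F F0] := lift_augmentation_endo C0 projC exC phie.
have Fid : homotopic F (chain_id C).
  by apply: (augmentation_homotopic_id C0 projC exC) => x; rewrite F0.
have [G FG] : is_cpx_iso F by apply: minC; exists (chain_id C).
by subst e; exists (G 0).
Qed.
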